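(* Let $A$ be a unital locally matrix algebra over a field $\mathbb{F}$ whose characteristic is not $2$. (1) If the Steinitz number $\mathbf{st}(A)$ is locally finite, then every normalized rank-preserving linear mapping $A \to A$ is either a homomorphism or an antihomomorphism. (2) If $\mathbf{st}(A)$ is not locally finite and $\dim_{\mathbb{F}} A = \aleph_0$, then there exists a normalized rank-preserving linear mapping $A \to A$ that is neither a homomorphism nor an antihomomorphism.
   Context: An associative $\mathbb{F}$-algebra $A$ is a locally matrix algebra if every finite subset of $A$ is contained in a subalgebra isomorphic to a matrix algebra $M_n(\mathbb{F})$ for some $n$; it is unital if it contains an identity element $1_A$. Normalized rank: let $A$ be a unital locally matrix algebra. For $a \in A$ choose a subalgebra $A' \subset A$ containing $1_A$ and $a$ with $A' \cong M_n(\mathbb{F})$; put $\overline{r}(a) = r(a)/n$, where $r(a)$ is the rank of $a$ as an $n\times n$ matrix. This does not depend on the choice of $A'$. A linear mapping $\varphi: A \to A$ is normalized rank-preserving if $\overline{r}(\varphi(a)) = \overline{r}(a)$ for all $a \in A$. An antihomomorphism $\psi : A \to B$ of associative algebras is a linear mapping with $\psi(a_1 a_2) = \psi(a_2)\psi(a_1)$ for all $a_1, a_2 \in A$. A Steinitz number is a formal product $\prod_{p \in \mathbb{P}} p^{r_p}$ over the set $\mathbb{P}$ of all primes, with $r_p \in \mathbb{N} \cup \{0, \infty\}$. It is locally finite if $r_p < \infty$ for all primes $p$. For a unital locally matrix algebra $A$ let $$D(A) = \{\, n \ge 1 \mid \text{there exists a subalgebra } A' \text{ such that } 1_A \in A'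 \subset A,\ A' \cong M_n(\mathbb{F}) \,\}.$$ The Steinitz number $\mathbf{st}(A)$ of $A$ is the least common multiple of all integers in $D(A)$, i.e. the Steinitz number in which the exponent of each prime $p$ is the supremum of the exponents of $p$ in the elements of $D(A)$.
   Formalization: The formal statement adds φ(1) = 1: as a hypothesis in (1), which fails without it (φ = −id preserves normalized rank but is neither a homomorphism nor an antihomomorphism), and as an extra property of the mapping constructed in (2). *)

(* Defs.v *)
From HB Require Import structures.
From mathcomp Require Import all_boot all_order all_algebra.
From mathcomp Require Import boolp classical_sets.

Set Implicit Arguments.
Unset Strict Implicit.
Unset Printing Implicit Defensive.

Import Order.TTheory GRing.Theory Num.Theory.
Local Open Scope classical_set_scope.
Local Open Scope ring_scope.

(* A subalgebra of A isomorphic to M_n(F), n >= 1, is presented by an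
   isomorphism f from 'M[F]_n onto it: the subalgebra is range f.  It need not
   contain 1, and f is not required to map the identity matrix to 1. *)
Definition matrix_embedding (F : fieldType) (A : algType F) (n : nat)
    (f : {linear 'M[F]_n -> A}) : Prop :=
  [/\ (0 < n)%N, injective f & forall x y : 'M[F]_n, f (x *m y) = f x * f y].

(* Unitality is built into algType, which also forces 1 != 0; this loses
   nothing because n >= 1 in matrix_embedding. *)
Definition locally_matrix (F : fieldType) (A : algType F) : Prop :=
  forall s : seq A, exists (n : nat) (f : {linear 'M[F]_n -> A}),
    matrix_embedding f /\ (forall a, a \in s -> range f a).

Definition is_normalized_rank (F : fieldType) (A : algType F) (a : A)
    (q : rat) : Prop :=
  exists (n : nat) (f : {linear 'M[F]_n -> A}) (x : 'M[F]_n),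
    [/\ matrix_embedding f, range f 1, f x = a & q = (\rank x)%:R / n%:R].

(* xget chooses the subalgebra; when A is locally matrix a value exists and
   does not depend on the choice, so the default 0 is never used. *)
Definition normalized_rank (F : fieldType) (A : algType F) (a : A) : rat :=
  xget 0 [set q | is_normalized_rank a q].

Definition normalized_rank_preserving (F : fieldType) (A : algType F)
    (phi : A -> A) : Prop :=
  forall a, normalized_rank (phi a) = normalized_rank a.

Definition homomorphism (F : fieldType) (A B : algType F)
    (phi : {linear A -> B}) : Prop :=
  forall a b, phi (a * b) = phi a * phi b.

Definition antihomomorphism (F : fieldType) (A B : algType F)
    (phi : {linear A -> B}) : Prop :=
  forall a b, phi (a * b) = phi b * phi a.

(* Exponents in N \cup {0, oo}: None stands for oo. *)
Definition steinitz : Type := {p : nat | prime p} -> option nat.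

Definition locally_finite (s : steinitz) : Prop := forall p, s p <> None.

(* Supremum in N \cup {oo}; ex_minn picks the least upper bound. *)
Definition exponent_sup (S : set nat) : option nat :=
  match pselect (exists m, `[< forall k, S k -> (k <= m)%N >]) with
  | left bounded => Some (ex_minn bounded)
  | right _ => None
  end.

Definition steinitz_lcm (D : set nat) : steinitz :=
  fun p => exponent_sup [set logn (val p) n | n in D].

Definition matrix_degrees (F : fieldType) (A : algType F) : set nat :=
  [set n | exists f : {linear 'M[F]_n -> A}, matrix_embedding f /\ range f 1].

Definition st (F : fieldType) (A : algType F) : steinitz :=
  steinitz_lcm (matrix_degrees A).

(* dim_F V = aleph_0: V has a basis indexed by nat. *)
Definition dim_aleph0 (F : fieldType) (V : lmodType F) : Prop :=
  exists b : nat -> V,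
    (forall (n : nat) (c : 'I_n -> F),
       \sum_(i < n) c i *: b i = 0 -> forall i, c i = 0) /\
    (forall v, exists (n : nat) (c : 'I_n -> F), v = \sum_(i < n) c i *: b i).

(* Main.v *)
(* Unital rank-preserving maps send idempotents to idempotents, because q is
   idempotent iff rank q + rank (1 - q) = n; polarizing over idempotents makes
   such a map a Jordan homomorphism on every unital matrix subalgebra, and a
   Jordan homomorphism of M_n (n >= 2) is the sum of a homomorphism h and an
   antihomomorphism with orthogonal ranges.  The idempotent h(1) does not depend on
   the subalgebra M_n, while the rank of h(1) in a matrix subalgebra M_N
   containing h(M_n) is divisible by n.  When st(A) is locally finite, taking n
   with maximal p-parts forces h(1) to have normalized rank 0 or 1.

   Conversely, if p^oo divides st(A), maps x |-> h(x) + g(x^T) with h(1) of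
   normalized rank 1/p can be extended along an increasing chain of matrix
   subalgebras exhausting A: two such maps M_n -> M_N with the same ranks are
   conjugate, so a model map on the larger subalgebra can be corrected by a
   conjugation. *)
Require Import Defs.
From HB Require Import structures.
From mathcomp Require Import all_boot all_order all_algebra.
From mathcomp Require Import boolp classical_sets.
From mathcomp Require Import zify.
Import Order.TTheory GRing.Theory Num.Theory.
Local Open Scope ring_scope.

Set Implicit Arguments.
Unset Strict Implicit.
Unset Printing Implicit Defensive.

(** * Ranks of multiplicative maps between matrix algebras *)

Section MatrixRank.
Variable F : fieldType.

(** The rows of [q] and [1 - q] together span everything, so the rank equality forces their row
    spaces to meet in 0; the rows of [q *m (1 - q)], which equals [(1 - q) *m q], lie in both. *)
Lemma idempotent_of_rank_compl (n : nat) (q : 'M[F]_n) :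
  (\rank q + \rank (1%:M - q)%R = n)%N -> q *m q = q.
Proof.
move=> rk.
have sum1 : \rank (q + (1%:M - q)%R)%MS = n.
  apply/eqP; rewrite eqn_leq rank_leq_row /=.
  rewrite -[X in (X <= _)%N](mxrank1 F n).
  apply: mxrankS; rewrite -[X in (X <= _)%MS](subrK q) addrC addmx_sub_adds //.
have cap0 : (q :&: (1%:M - q)%R)%MS = 0.
  apply/eqP; rewrite -mxrank_eq0 -(eqn_add2l n) addn0.
  by rewrite -[X in (X + _)%N]sum1 mxrank_sum_cap rk.
suff : q *m (1%:M - q) = 0.
  by rewrite mulmxBr mulmx1 => /eqP; rewrite subr_eq0 => /eqP.
apply/eqP; rewrite -submx0 -cap0 sub_capmx submxMl andbT.
rewrite mulmxBr mulmx1 -[X in (X - _)]mul1mx -mulmxBl; exact: submxMl.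
Qed.

(** Right multiplication by [e] fixes the row space of [x] and kills that of [y], so they meet in 0;
    left multiplication by [e] and [1 - e] recovers [x] and [y] from the sum. *)
Lemma mxrank_orth_add (n : nat) (e x y : 'M[F]_n) :
  e *m x = x -> x *m e = x -> e *m y = 0 -> y *m e = 0 ->
  \rank (x + y)%R = (\rank x + \rank y)%N.
Proof.
move=> ex xe ey ye; apply/eqP; rewrite eqn_leq; apply/andP; split; first exact: mxrank_add.
have cap0 : (x :&: y)%MS = 0.
  have /submxP[a ha] : (x :&: y <= x)%MS by rewrite capmxSl.
  have /submxP[b hb] : (x :&: y <= y)%MS by rewrite capmxSr.
  have: (x :&: y)%MS *m e = 0 by rewrite hb -mulmxA ye mulmx0.
  by rewrite {1}ha -mulmxA xe -ha.
rewrite -(mxrank_sum_cap x y) cap0 mxrank0 addn0; apply: mxrankS.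
have sx : (x <= (x + y)%R)%MS.
  by apply/submxP; exists e; rewrite mulmxDr ex ey addr0.
rewrite addsmx_sub sx /=.
apply/submxP; exists (1%:M - e).
by rewrite mulmxBl mul1mx mulmxDr ex ey addr0 addrC addKr.
Qed.

Lemma mxrank_idempotent_compl (N : nat) (e : 'M[F]_N) :
  e *m e = e -> (\rank e + \rank (1%:M - e)%R = N)%N.
Proof.
move=> ee; rewrite -(mxrank_orth_add ee ee) ?subrKC ?mxrank1 //.
  by rewrite mulmxBr mulmx1 ee subrr.
by rewrite mulmxBl mul1mx ee subrr.
Qed.

(** Cancelling the full-rank factors on both sides of [q *m q = q] leaves [r *m l = 1]. *)
Lemma idem_rank_factor (n a : nat) (q : 'M[F]_n) :
  q *m q = q -> \rank q = a ->
  exists (l : 'M[F]_(n, a)) (r : 'M[F]_(a, n)), q = l *m r /\ r *m l = 1%:M.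
Proof.
move=> qq <-; exists (col_base q), (row_base q); split; first by rewrite mulmx_base.
have E : col_base q *m (row_base q *m col_base q) *m row_base q
       = col_base q *m 1%:M *m row_base q.
  by rewrite mulmx1 mulmxA -mulmxA mulmx_base qq.
apply: (row_full_inj (col_base_full q)).
by apply: (row_free_inj (row_base_free q)).
Qed.

Lemma mxrank_factor_conj (n a : nat) (l : 'M[F]_(n, a)) (r : 'M[F]_(a, n)) d :
  r *m l = 1%:M -> \rank (l *m d *m r) = \rank d.
Proof.
move=> rl; apply/eqP; rewrite eqn_leq; apply/andP; split.
  by apply: leq_trans (mxrankM_maxl _ _) _; apply: mxrankM_maxr.
have -> : \rank d = \rank (r *m (l *m d *m r) *m l).
  by rewrite !mulmxA rl mul1mx -mulmxA rl mulmx1.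
by apply: leq_trans (mxrankM_maxl _ _) _; apply: mxrankM_maxr.
Qed.

Section Multiplicative.
Variables (n N : nat) (h : {linear 'M[F]_n -> 'M[F]_N}).
Hypothesis hM : forall x y, h (x *m y) = h x *m h y.

Lemma mxrank_mul_le x y z : (\rank (h (x *m y *m z)) <= \rank (h y))%N.
Proof.
by rewrite !hM; apply: leq_trans (mxrankM_maxl _ _) _; apply: mxrankM_maxr.
Qed.

Lemma mxrank_mul_delta i j :
  \rank (h (delta_mx i i)) = \rank (h (delta_mx j j)).
Proof.
suff le i' j' : (\rank (h (delta_mx i' i')) <= \rank (h (delta_mx j' j')))%N.
  by apply/eqP; rewrite eqn_leq !le.
have -> : delta_mx i' i' = delta_mx i' j' *m delta_mx j' j' *m delta_mx j' i' :> 'M[F]_n.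
  by rewrite !mul_delta_mx.
exact: mxrank_mul_le.
Qed.

Lemma mxrank_mul_pid (i0 : 'I_n) r : (r <= n)%N ->
  \rank (h (pid_mx r)) = (r * \rank (h (delta_mx i0 i0)))%N.
Proof.
elim: r => [|r IH] rn; first by rewrite pid_mx_0 linear0 mxrank0.
have E : pid_mx r.+1 = pid_mx r + delta_mx (Ordinal rn) (Ordinal rn) :> 'M[F]_n.
  apply/matrixP => i j; rewrite !mxE ltnS leq_eqVlt -!val_eqE /=.
  have [<-|ij] := eqVneq (val i) (val j); rewrite /= ?andbb.
    by case: (ltngtP (val i) r) => ?; rewrite ?addr0 ?add0r.
  rewrite add0r; case: (eqVneq (val i) r) => [ir|//].
  by rewrite -ir eq_sym (negbTE ij).
have D0 : pid_mx r *m delta_mx (Ordinal rn) (Ordinal rn) = 0 :> 'M[F]_n.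
  apply/matrixP => i j; rewrite !mxE big1 // => k _; rewrite !mxE.
  case: eqP => [->|]; rewrite ?mul0r //=; case: eqP => [->|]; rewrite ?mulr0 //=.
  by rewrite ltnn mul0r.
have D1 : delta_mx (Ordinal rn) (Ordinal rn) *m pid_mx r = 0 :> 'M[F]_n.
  apply/matrixP => i j; rewrite !mxE big1 // => k _; rewrite !mxE.
  case: (k =P Ordinal rn) => [->|]; rewrite ?andbF ?mul0r //= ltnn andbF mulr0 //.
have pp : (pid_mx r : 'M[F]_n) *m (pid_mx r : 'M[F]_n) = pid_mx r by rewrite pid_mx_id // ltnW.
rewrite E linearD (@mxrank_orth_add _ (h (pid_mx r))) -?hM ?pp ?D0 ?D1 ?linear0 //.
by rewrite IH ?(ltnW rn) // (mxrank_mul_delta _ i0) mulSn addnC.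
Qed.

(** Up to invertible factors [x] is a sum of [\rank x] orthogonal diagonal units, whose images all
    have the same rank; [mxrank_mul_le] absorbs the invertible factors, even when [h] is not
    unital. *)
Lemma mxrank_mul (i0 : 'I_n) x :
  \rank (h x) = (\rank x * \rank (h (delta_mx i0 i0)))%N.
Proof.
rewrite -mxrank_mul_pid ?rank_leq_row //; apply/eqP; rewrite eqn_leq.
apply/andP; split; first by rewrite -{1}(mulmx_ebase x) mxrank_mul_le.
have -> : pid_mx (\rank x) = invmx (col_ebase x) *m x *m invmx (row_ebase x).
  rewrite -[X in _ = _ *m X *m _]mulmx_ebase !mulmxA.
  by rewrite mulVmx ?col_ebase_unit // mul1mx mulmxK ?row_ebase_unit.
exact: mxrank_mul_le.
Qed.

End Multiplicative.
End MatrixRank.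

(** * Jordan homomorphisms of matrix algebras *)

Lemma linear_mx_eq0 (F : fieldType) (V : lmodType F) (m n : nat)
    (f : 'M[F]_(m, n) -> V) :
  linear f -> (forall i j, f (delta_mx i j) = 0) -> forall x, f x = 0.
Proof.
move=> lf f0 x.
pose g : {linear _ -> _} := HB.pack f (GRing.isLinear.Build F _ V _ f lf).
rewrite -[f x]/(g x) (matrix_sum_delta x) linear_sum big1 // => i _.
by rewrite linear_sum big1 // => j _; rewrite linearZ /= f0 scaler0.
Qed.

Section Jordan.
Variables (F : fieldType) (A : algType F) (n : nat) (Phi : {linear 'M[F]_n -> A}).
Hypothesis charF : 2%N \notin [pchar F].
Hypothesis idemP : forall x, x *m x = x -> Phi x * Phi x = Phi x.

Lemma two_neq0 : 2%:R != 0 :> F.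
Proof. by move: charF; rewrite inE /=. Qed.

Lemma addvv_eq0 (V : lmodType F) (a : V) : a + a = 0 -> a = 0.
Proof.
by rewrite -mulr2n -scaler_nat => /eqP; rewrite scaler_eq0 (negbTE two_neq0) => /eqP.
Qed.

Let B x y := Phi (x *m y + y *m x) - (Phi x * Phi y + Phi y * Phi x).

Let Bsym x y : B x y = B y x.
Proof. by rewrite /B addrC [_ * _ + _]addrC (addrC (_ *m _)) addrC. Qed.

Let Blin z : linear (B ^~ z).
Proof.
move=> a x y; rewrite /B mulmxDl mulmxDr -scalemxAl -scalemxAr !(linearD Phi) !linearZ_LR.
rewrite !mulrDl !mulrDr -!scalerAl -!scalerAr.
rewrite (addrACA (a *: Phi _)) (addrACA (a *: (_ * _))) -!scalerDr.
by rewrite opprD addrACA -scalerBr.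
Qed.

Let BDl x y z : B (x + y) z = B x z + B y z.
Proof. by have := Blin z 1 x y; rewrite !scale1r. Qed.
Let BDr x y z : B z (x + y) = B z x + B z y.
Proof. by rewrite ![B z _]Bsym BDl. Qed.
Let B0l z : B 0 z = 0.
Proof. by apply: (addrI (B 0 z)); rewrite -BDl !addr0. Qed.
Let BZl a x z : B (a *: x) z = a *: B x z.
Proof. by have := Blin z a x 0; rewrite !addr0 B0l addr0. Qed.
Let BNl x z : B (- x) z = - B x z.
Proof. by rewrite -scaleN1r BZl scaleN1r. Qed.
Let BNr x z : B z (- x) = - B z x.
Proof. by rewrite ![B z _]Bsym BNl. Qed.

Let B_idem p : p *m p = p -> B p p = 0.
Proof. by move=> pp; rewrite /B pp linearD idemP // subrr. Qed.

(** If [w *m v] is nonzero, [v *m w] is a multiple of an idempotent. Otherwise pick [w'] with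
    [w' *m v = 1]: the settled case applies to [w'], [w' + w] and [w' - w], and adding the last two
    leaves twice the claim. *)
Let B_rank1 (v : 'cV_n) (w : 'rV_n) : B (v *m w) (v *m w) = 0.
Proof.
have trace_neq0 (w1 : 'rV_n) : (w1 *m v) 0 0 != 0 -> B (v *m w1) (v *m w1) = 0.
  move=> t0; set t := (w1 *m v) 0 0 in t0.
  have E : v *m w1 = t *: (t^-1 *: (v *m w1)) by rewrite scalerA mulfV // scale1r.
  rewrite E BZl Bsym BZl B_idem ?scaler0 //.
  rewrite -scalemxAl -scalemxAr mulmxA -(mulmxA v) [w1 *m v]mx11_scalar -/t.
  by rewrite mul_mx_scalar -scalemxAl !scalerA mulVf // mulr1.
have [t0|] := eqVneq ((w *m v) 0 0) 0; last exact: trace_neq0.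
have [->|/matrix0Pn[i [j]]] := eqVneq v 0; first by rewrite mul0mx B0l.
rewrite ord1 => vi; set w' : 'rV_n := (v i 0)^-1 *: delta_mx 0 i.
have w'v s : ((w' + s *: w) *m v) 0 0 = 1.
  rewrite mulmxDl -!scalemxAl mxE [X in _ + X]mxE t0 mulr0 addr0 mxE.
  by rewrite -rowE mxE mulVf.
have := trace_neq0 (w' + 1 *: w); have := trace_neq0 (w' + (- 1) *: w).
have := trace_neq0 (w' + 0 *: w).
rewrite !w'v scale0r addr0 scale1r scaleN1r oner_neq0 => /(_ isT) a0 /(_ isT) a1 /(_ isT).
move: a1; rewrite !mulmxDr !mulmxN !BDl !BDr !BNl !BNr a0 !add0r opprK.
move=> a1 a2; apply: addvv_eq0; have := congr2 +%R a1 a2.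
by rewrite addr0 addrACA addNr add0r addrACA addNr add0r.
Qed.

Let B_polar x y : B x x = 0 -> B y y = 0 -> B (x + y) (x + y) = 0 -> B x y = 0.
Proof.
rewrite BDl !BDr => -> ->; rewrite add0r addr0 (Bsym y) => ?; exact: addvv_eq0.
Qed.

Let B_col (v : 'cV_n) (w w' : 'rV_n) : B (v *m w) (v *m w') = 0.
Proof. by apply: B_polar; rewrite -?mulmxDr B_rank1. Qed.

Let B_row (v v' : 'cV_n) (w : 'rV_n) : B (v *m w) (v' *m w) = 0.
Proof. by apply: B_polar; rewrite -?mulmxDl B_rank1. Qed.

Let B_swap (v v' : 'cV_n) (w w' : 'rV_n) :
  B (v *m w) (v' *m w') = - B (v *m w') (v' *m w).
Proof.
have := B_row v v' (w + w'); rewrite !mulmxDr BDl !BDr !B_row add0r addr0.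
by move/eqP; rewrite addr_eq0 => /eqP.
Qed.

Let B_orth (v v' : 'cV_n) (w w' : 'rV_n) :
  w *m v = 1%:M -> w *m v' = 0 -> w' *m v = 0 -> w' *m v' = 1%:M ->
  B (v *m w) (v' *m w') = 0.
Proof.
move=> wv wv' w'v w'v'; apply: B_polar; rewrite ?B_rank1 // B_idem //.
rewrite mulmxDl !mulmxDr !mulmxA -!(mulmxA v) -!(mulmxA v') wv wv' w'v w'v'.
by rewrite !mul1mx !mul0mx !mulmx0 addr0 add0r.
Qed.

(* For fixed columns, (w, w') |-> B (v w) (v' w') is alternating, and B_orth makes it
   vanish near a dual pair; both facts together make it vanish on unit rows. *)
Let B_delta i j k l : B (delta_mx i j) (delta_mx k l) = 0.
Proof.
rewrite -(mul_delta_mx (0 : 'I_1) i j) -(mul_delta_mx (0 : 'I_1) k l).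
have [<-|ik] := eqVneq i k; first exact: B_col.
set v := delta_mx i 0; set v' := delta_mx k 0.
pose C w w' := B (v *m w) (v' *m w').
have CDl x y w : C (x + y) w = C x w + C y w by rewrite /C mulmxDr BDl.
have CDr x y w : C w (x + y) = C w x + C w y by rewrite /C mulmxDr BDr.
have Cs x y : C x y = - C y x by apply: B_swap.
have C0 x : C x x = 0 by apply: B_row.
pose e a : 'rV[F]_n := delta_mx 0 a.
pose kills (y : 'rV_n) := y *m v = 0 /\ y *m v' = 0.
have k0 : kills 0 by rewrite /kills !mul0mx.
have ev a b : e a *m delta_mx b 0 = (a == b)%:R%:M.
  rewrite /e mul_delta_mx_cond; apply/matrixP => s t; rewrite !ord1 !mxE eqxx.
  by case: (a == b); rewrite /= ?mulr1n ?mulr0n !mxE ?eqxx.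
have ke a : a != i -> a != k -> kills (e a).
  by move=> ai ak; rewrite /kills /v /v' !ev (negbTE ai) (negbTE ak) raddf0.
(* The rows [e i + y], [e k + z] are still dual to the columns [v], [v'], because [y] and [z] kill
   both. *)
have Cyz y z : kills y -> kills z -> C (e i + y) (e k + z) = 0.
  move=> [y1 y2] [z1 z2]; apply: B_orth; rewrite mulmxDl ?y1 ?y2 ?z1 ?z2 addr0 ev.
  - by rewrite eqxx.
  - by rewrite (negbTE ik) raddf0.
  - by rewrite eq_sym (negbTE ik) raddf0.
  - by rewrite eqxx.
have Cik : C (e i) (e k) = 0 by rewrite -(addr0 (e i)) -(addr0 (e k)); apply: Cyz.
have Ciz z : kills z -> C (e i) z = 0.
  by move=> kz; have := Cyz 0 z k0 kz; rewrite addr0 CDr Cik add0r.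
have Cyk y : kills y -> C y (e k) = 0.
  by move=> ky; have := Cyz y 0 ky k0; rewrite addr0 CDl Cik add0r.
have Cab y z : kills y -> kills z -> C y z = 0.
  move=> ky kz; have := Cyz y z ky kz.
  by rewrite CDl !CDr Cik Ciz // Cyk // !add0r.
rewrite -/(C (e j) (e l)).
have [->|ji] := eqVneq j i.
  have [->|li] := eqVneq l i; first exact: C0.
  have [->|lk] := eqVneq l k; [exact: Cik | exact/Ciz/ke].
have [->|jk] := eqVneq j k.
  have [->|lk] := eqVneq l k; first exact: C0.
  rewrite Cs; have [->|li] := eqVneq l i; rewrite ?Cik ?oppr0 // Cyk ?oppr0 //.
  exact: ke.
have [->|li] := eqVneq l i; first by rewrite Cs Ciz ?oppr0 //; apply: ke.
have [->|lk] := eqVneq l k; first exact/Cyk/ke.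
by apply: Cab; apply: ke.
Qed.

Lemma jordan_of_idempotents x y :
  Phi (x *m y + y *m x) = Phi x * Phi y + Phi y * Phi x.
Proof.
apply/eqP; rewrite -subr_eq0; apply/eqP; rewrite -/(B x y).
move: x; apply: (@linear_mx_eq0 F A n n (B ^~ y)) => // i j; rewrite Bsym.
by move: y; apply: (@linear_mx_eq0 F A n n (B ^~ _)) => // k l.
Qed.

End Jordan.

(** Jordan products determine twice [xyz + zyx]; hence, outside characteristic 2, a Jordan
    homomorphism preserves [xyz + zyx]. *)
Lemma jordan_triple_identity (R : pzRingType) (x y z : R) :
  (x * (y * z + z * y) + (y * z + z * y) * x)
    + (z * (x * y + y * x) + (x * y + y * x) * z)
  = (y * (x * z + z * x) + (x * z + z * x) * y)
    + (x * y * z + z * y * x) + (x * y * z + z * y * x).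
Proof.
rewrite !mulrDr !mulrDl !mulrA !addrA.
by rewrite [LHS](ACl (8*3*2*5*1*4*7*6)).
Qed.

(** * Splitting a Jordan homomorphism into a homomorphism and an antihomomorphism *)

Section JordanSplitting.
Variables (F : fieldType) (A : algType F) (n : nat) (Phi : {linear 'M[F]_n -> A}).
Hypothesis charF : 2%N \notin [pchar F].
Hypothesis jordan : forall x y,
  Phi (x *m y + y *m x) = Phi x * Phi y + Phi y * Phi x.

Let e i j := Phi (delta_mx i j).

Let double_inj (a b : A) : a + a = b + b -> a = b.
Proof.
move=> ab; apply/eqP; rewrite -subr_eq0; apply/eqP.
apply: (@addvv_eq0 F charF A).
by rewrite addrACA ab addrACA subrr addr0.
Qed.

Let PhiD x y : Phi (x *m y) + Phi (y *m x) = Phi x * Phi y + Phi y * Phi x.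
Proof. by rewrite -jordan linearD. Qed.

Let sq x : Phi (x *m x) = Phi x * Phi x.
Proof. exact/double_inj/PhiD. Qed.

Let triple x y z :
  Phi (x *m y *m z) + Phi (z *m y *m x) = Phi x * Phi y * Phi z + Phi z * Phi y * Phi x.
Proof.
have I : (x *m (y *m z + z *m y) + (y *m z + z *m y) *m x)
    + (z *m (x *m y + y *m x) + (x *m y + y *m x) *m z)
  = (y *m (x *m z + z *m x) + (x *m z + z *m x) *m y)
    + (x *m y *m z + z *m y *m x) + (x *m y *m z + z *m y *m x).
  exact: jordan_triple_identity.
move: (congr1 Phi I).
rewrite (linearD Phi _ (z *m _ + _)) 2!(linearD Phi _ (x *m y *m z + _)) !jordan.
rewrite jordan_triple_identity -!(addrA (_ * _ + _)) => /addrI/esym.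
by move/double_inj; rewrite linearD.
Qed.

Let eM i j k l :
  e i j * e k l + e k l * e i j = e i l *+ (j == k) + e k j *+ (l == i).
Proof. by rewrite -PhiD !mul_delta_mx_cond !linearMn. Qed.

Let eii i : e i i * e i i = e i i.
Proof. by rewrite -sq mul_delta_mx. Qed.

(** By [eM] the idempotent [e i i] anticommutes with [e k l]; multiplying this relation by [e i i]
    on either side shows that they also commute, so twice the product is 0. *)
Let eii0 i k l : k != i -> l != i -> e i i * e k l = 0.
Proof.
move=> ki li; have := eM i i k l; rewrite eq_sym (negbTE ki) (negbTE li) !mulr0n addr0.
move=> H.
have H1 : e i i * e k l + e i i * e k l * e i i = 0.
  by have := congr1 (fun u => e i i * u) H; rewrite /= mulrDr mulr0 !mulrA eii.
have H2 : e i i * e k l * e i i + e k l * e i i = 0.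
  by have := congr1 (fun u => u * e i i) H; rewrite /= mulrDl mul0r -[X in _ + X]mulrA eii.
set q := e i i * e k l * e i i in H1 H2.
have px : e i i * e k l = - q by apply/eqP; rewrite -addr_eq0 H1.
have xp : e k l * e i i = - q by apply/eqP; rewrite -addr_eq0 addrC H2.
by move: H; rewrite px xp; apply: (@addvv_eq0 F charF A).
Qed.

Let sub_eM i j k l :
  e i j * e k l = e i l *+ (j == k) + e k j *+ (l == i) - e k l * e i j.
Proof. by rewrite -eM addrK. Qed.

Section Absorbing.
Variables i a : 'I_n.
Hypothesis ai : a != i.
(* If Phi is the sum of a homomorphism h and an antihomomorphism, then t = h(E_ia). *)
Let t := e i i * e i a.

Let t_kill k l : k != a -> t * e k l = 0.
Proof.
move=> ka; rewrite /t; have [->|la] := eqVneq l a.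
  rewrite -mulrA sub_eM [a == k]eq_sym (negbTE ka) (negbTE ai) !mulr0n addr0 sub0r mulrN.
  have [->|ki] := eqVneq k i; last by rewrite mulrA eii0 // mul0r oppr0.
  by rewrite -sq mul_delta_mx_cond (negbTE ai) mulr0n linear0 mulr0 oppr0.
have -> : e i i * e i a = e i i * e i a * e a a.
  rewrite -[RHS]mulrA (sub_eM i a a a) eqxx (negbTE ai) mulr0n addr0 mulrBr.
  by rewrite [X in _ - X]mulrA (eii0 ai ai) mul0r subr0.
by rewrite -mulrA (eii0 ka la) mulr0.
Qed.

(** The defect [D] is alternating because [Phi] is Jordan. As [t] kills [e k l] unless [k = a], only
    the pairs [E_al], [E_as] remain, and alternation reduces these to [s != i]. *)
Lemma jordan_absorb x y : t * Phi (x *m y) = t * Phi x * Phi y.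
Proof.
pose D x y := t * (Phi (x *m y) - Phi x * Phi y).
suff : D x y = 0 by rewrite /D mulrBr mulrA => /eqP; rewrite subr_eq0 => /eqP.
have Dl z : linear (D ^~ z).
  move=> c u v; rewrite /D mulmxDl -scalemxAl !(linearD Phi) !linearZ_LR mulrDl -scalerAl.
  by rewrite opprD addrACA -scalerBr mulrDr -scalerAr.
have Ds u v : D u v = - D v u.
  rewrite /D -[RHS]mulrN opprB; congr (_ * _); apply/eqP.
  by rewrite subr_eq addrAC eq_sym subr_eq addrC -PhiD.
have D0 u : D u u = 0 by rewrite /D sq subrr mulr0.
have Ddelta1 k l r s : k != a -> D (delta_mx k l) (delta_mx r s) = 0.
  move=> ka; rewrite /D mul_delta_mx_cond linearMn mulrBr mulrA -!/(e _ _).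
  by rewrite mulrnAr !t_kill // mul0rn mul0r subr0.
have Ddelta2 l s : s != i -> D (delta_mx a l) (delta_mx a s) = 0.
  move=> si; rewrite /D mul_delta_mx_cond linearMn -!/(e _ _) mulrBr.
  apply/eqP; rewrite subr_eq0; apply/eqP; rewrite /t.
  have e0 : e i i * e a s = 0 by apply: eii0.
  (* Left multiplication by [e i i] removes the reversed terms, a multiple of [e a a] and a product
     starting with [e a s], both killed by [eii0]. *)
  have := triple (delta_mx i a) (delta_mx a l) (delta_mx a s).
  rewrite mul_delta_mx !mul_delta_mx_cond.
  have -> : (delta_mx a l *+ (s == a)) *m delta_mx i a
      = delta_mx a a *+ (l == i) *+ (s == a) :> 'M[F]_n.
    by case: (s == a); rewrite ?mul0mx // !mulr1n mul_delta_mx_cond.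
  rewrite !linearMn -!/(e _ _) => /(congr1 (fun u => e i i * u)).
  rewrite !mulrDr !mulrnAr (eii0 ai ai) !mul0rn addr0 !mulrA e0 !mul0r addr0 => <-.
  congr (_ *+ _); rewrite -mulrA (sub_eM i a a s) (negbTE si) eqxx mulr0n addr0 mulrBr.
  by rewrite [X in _ - X]mulrA e0 mul0r subr0.
have Ddelta k l r s : D (delta_mx k l) (delta_mx r s) = 0.
  have [->|ka] := eqVneq k a; last exact: Ddelta1.
  have [->|ra] := eqVneq r a; last by rewrite Ds Ddelta1 ?oppr0.
  have [->|si] := eqVneq s i; last exact: Ddelta2.
  have [->|li] := eqVneq l i; first exact: D0.
  by rewrite Ds Ddelta2 ?oppr0.
move: x; apply: (@linear_mx_eq0 F A n n (D ^~ y)) => // k l; rewrite Ds.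
apply/eqP; rewrite oppr_eq0; apply/eqP.
by move: y; apply: (@linear_mx_eq0 F A n n (D ^~ _)) => // r s.
Qed.

End Absorbing.

Lemma jordan_diag i a : a != i ->
  e i i * e i a * e a i + e i i * e a i * e i a = e i i.
Proof.
by move=> ai; rewrite -!mulrA -mulrDr eM !eqxx mulrDr eii (eii0 ai ai) addr0.
Qed.

Lemma jordan_offdiag k l : k != l -> e k k * e k l + e l l * e k l = e k l.
Proof.
move=> kl; have lk : l != k by rewrite eq_sym.
have Ek : e k k * e k l = e k l - e k l * e k k.
  by rewrite (sub_eM k k k l) eqxx (negbTE lk) mulr0n addr0.
have El : e l l * e k l = e k l - e k l * e l l.
  by rewrite (sub_eM l l k l) eqxx (negbTE lk) mulr0n add0r.
have -> : e l l * e k l = e k l * e k k; last by rewrite Ek subrK.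
have klk : e l l * e k l = e l l * e k l * e k k.
  rewrite -{1}(subrK (e k l * e k k) (e k l)) -Ek mulrDr mulrA (eii0 kl kl).
  by rewrite mul0r add0r mulrA.
by rewrite klk El mulrBl -[X in _ - X]mulrA (eii0 kl kl) mulr0 subr0.
Qed.

Variable alt : 'I_n -> 'I_n.
Hypothesis altP : forall i, alt i != i.

(** If [Phi] splits into orthogonal parts, its homomorphism part must satisfy
    [h (E_ii x) = h (E_ia) * Phi (E_ai x)] with [a = alt i]; summing over [i] defines [h]. The
    absorption law [h x * Phi y = h (x *m y)] comes from [jordan_absorb] and yields
    multiplicativity. *)
Lemma jordan_hom_part : exists h : {linear 'M[F]_n -> A},
  [/\ forall x y, h (x *m y) = h x * h y,
      forall x y, h x * Phi y = h (x *m y) &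
      forall k l, h (delta_mx k l) =
        if k == l then e k k * e k (alt k) * e (alt k) k else e k k * e k l].
Proof.
pose t i := e i i * e i (alt i).
pose h0 x := \sum_i t i * Phi (delta_mx (alt i) i *m x).
have lh : linear h0.
  move=> c x y; rewrite /h0 scaler_sumr -big_split; apply: eq_bigr => i _ /=.
  by rewrite mulmxDr (linearD Phi) -scalemxAr linearZ_LR mulrDr -scalerAr.
pose h : {linear _ -> _} := HB.pack h0 (GRing.isLinear.Build F _ A _ h0 lh).
have hE x : h x = \sum_i t i * Phi (delta_mx (alt i) i *m x) by [].
have hPhi x y : h x * Phi y = h (x *m y).
  rewrite !hE mulr_suml; apply: eq_bigr => i _.
  by rewrite mulmxA -jordan_absorb.
have hd k l : h (delta_mx k l) = t k * e (alt k) l.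
  rewrite hE (bigD1 k) //= mul_delta_mx big1 ?addr0 // => i ik.
  by rewrite mul_delta_mx_cond (negbTE ik) mulr0n linear0 mulr0.
exists h; split => //.
  move=> x y; rewrite (hE y) mulr_sumr.
  rewrite -[in LHS](mul1mx y) [in LHS]mx1_sum_delta mulmx_suml mulmx_sumr linear_sum.
  apply: eq_bigr => i _; rewrite /t !mulrA !hPhi.
  by rewrite -!mulmxA; congr (h (x *m _)); rewrite !mulmxA !mul_delta_mx.
move=> k l; rewrite hd /t; case: eqVneq => [->//|kl].
have lk : l != k by rewrite eq_sym.
have ak := altP k.
rewrite -mulrA (sub_eM k (alt k) (alt k) l) eqxx (negbTE lk) mulr0n addr0 mulrBr.
by rewrite [X in _ - X]mulrA (eii0 ak lk) mul0r subr0.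
Qed.

End JordanSplitting.

(** [k] is the homomorphism part of [Phi] composed with transposition. The sum is checked on matrix
    units, and absorption gives orthogonality: [h x * k y = h x * (Phi y^T - h y^T) = 0]. *)
Lemma jordan_decomposition (F : fieldType) (A : algType F) (n : nat)
    (Phi : {linear 'M[F]_n -> A}) :
  2%N \notin [pchar F] -> (1 < n)%N ->
  (forall x y, Phi (x *m y + y *m x) = Phi x * Phi y + Phi y * Phi x) ->
  exists h k : {linear 'M[F]_n -> A},
  [/\ forall x y, h (x *m y) = h x * h y, forall x y, k (x *m y) = k x * k y,
     forall x y, h x * k y = 0, forall x y, k x * h y = 0 &
     forall x, Phi x = h x + k x^T].
Proof.
case: n Phi => [|[|n]] // Phi charF _ jordan.
(* The splitting needs a second index for each index; this is where [1 < n] enters. *)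
pose alt (i : 'I_n.+2) : 'I_n.+2 := if i == 0 then 1 else 0.
have altP i : alt i != i.
  by rewrite /alt; have [->|] := eqVneq i 0; last rewrite eq_sym.
have lPsi : linear (fun x : 'M[F]_n.+2 => Phi x^T).
  by move=> c x y; rewrite linearP linearP.
pose Psi : {linear _ -> _} :=
  HB.pack (fun x : 'M[F]_n.+2 => Phi x^T) (GRing.isLinear.Build F _ A _ _ lPsi).
have jordanT x y : Psi (x *m y + y *m x) = Psi x * Psi y + Psi y * Psi x.
  rewrite /Psi /= -jordan addrC; congr (Phi _).
  by rewrite linearD /= !trmx_mul.
have [h [hM hPhi hd]] := jordan_hom_part charF jordan altP.
have [k [kM kPsi kd]] := jordan_hom_part charF jordanT altP.
have E x : Phi x = h x + k x^T.
  apply/eqP; rewrite -subr_eq0; apply/eqP.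
  move: x; apply: linear_mx_eq0.
    move=> c x y; rewrite (linearP Phi) (linearP h) (linearP trmx) (linearP k).
    by rewrite (addrACA (c *: h x)) -scalerDr opprD addrACA -scalerBr.
  move=> i j; rewrite hd trmx_delta kd /= !trmx_delta eq_sym.
  have [->|ij] := eqVneq i j.
    by rewrite (jordan_diag charF jordan (altP j)) subrr.
  by rewrite (jordan_offdiag charF jordan ij) subrr.
exists h, k; split => //.
- move=> x y; have -> : k y = Phi y^T - h y^T by rewrite E trmxK addrAC subrr add0r.
  by rewrite mulrBr hPhi hM subrr.
- move=> x y; have -> : h y = Psi y^T - k y^T by rewrite /Psi /= trmxK E addrK.
  by rewrite mulrBr kPsi kM subrr.
Qed.

(** * Unital matrix subalgebras *)

Lemma lift_linear (F : fieldType) (A : lmodType F) (n m : nat)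
    (g : {linear 'M[F]_m -> A}) (f : {linear 'M[F]_n -> A}) :
  injective g -> (forall x, exists y, g y = f x) ->
  exists H : {linear 'M[F]_n -> 'M[F]_m}, forall x, g (H x) = f x.
Proof.
move=> ginj /choice[H0 H0E].
have lH : linear H0.
  by move=> c x y; apply: ginj; rewrite H0E !linearP !H0E.
pose H : {linear _ -> _} := HB.pack H0 (GRing.isLinear.Build F _ _ _ _ lH).
by exists H.
Qed.

Section LocallyMatrix.
Variables (F : fieldType) (A : algType F).

Definition unital_embedding (n : nat) (f : {linear 'M[F]_n -> A}) : Prop :=
  matrix_embedding f /\ f 1%:M = 1.

Definition covers (m : nat) (g : {linear 'M[F]_m -> A}) (a : A) : Prop :=
  exists y, g y = a.

Lemma unital_embedding_range n (f : {linear 'M[F]_n -> A}) :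
  matrix_embedding f -> range f 1%R -> unital_embedding f.
Proof.
move=> ef [x _ fx]; split=> //; case: ef => _ _ fM.
by rewrite -[LHS]mulr1 -fx -fM mul1mx.
Qed.

Lemma range_unital_embedding n (f : {linear 'M[F]_n -> A}) :
  unital_embedding f -> range f 1%R.
Proof. by case=> _ f1; exists 1%:M. Qed.

(** Local matricity speaks of finite sets, so the matrix units stand in for the whole subalgebra. *)
Definition mx_gens n (f : {linear 'M[F]_n -> A}) : seq A :=
  [seq f (delta_mx ij.1 ij.2) | ij : 'I_n * 'I_n].

Lemma covers_gens n m (f : {linear 'M[F]_n -> A}) (g : {linear 'M[F]_m -> A}) :
  (forall a, a \in mx_gens f -> covers g a) -> forall x, covers g (f x).
Proof.
move=> cov x.
have cd (ij : 'I_n * 'I_n) : exists y, g y = f (delta_mx ij.1 ij.2).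
  by apply: cov; apply/mapP; exists ij; rewrite ?mem_enum.
have [Y YE] := choice cd.
exists (\sum_i \sum_j x i j *: Y (i, j)).
rewrite [x in RHS]matrix_sum_delta !linear_sum; apply: eq_bigr => i _.
by rewrite !linear_sum; apply: eq_bigr => j _; rewrite !linearZ /= YE.
Qed.

Lemma lift_morphism n m (h : {linear 'M[F]_n -> A}) (g : {linear 'M[F]_m -> A}) :
  unital_embedding g -> (forall x, covers g (h x)) ->
  (forall x y, h (x *m y) = h x * h y) ->
  exists H : {linear 'M[F]_n -> 'M[F]_m},
    (forall x, g (H x) = h x) /\ (forall x y, H (x *m y) = H x *m H y).
Proof.
move=> [[_ ginj gM] _] cov hM; have [H HE] := lift_linear ginj cov.
by exists H; split=> // x y; apply: ginj; rewrite gM !HE hM.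
Qed.

(** Ranks are multiplied by the rank [k] of the image of a diagonal unit; evaluating at the identity
    gives [m = k * n]. *)
Lemma embedding_degree n m (f : {linear 'M[F]_n -> A}) (g : {linear 'M[F]_m -> A}) :
  unital_embedding f -> unital_embedding g -> (forall x, covers g (f x)) ->
  exists k (H : {linear 'M[F]_n -> 'M[F]_m}),
    [/\ m = (k * n)%N, forall x, g (H x) = f x,
        forall x y, H (x *m y) = H x *m H y &
        forall x, \rank (H x) = (\rank x * k)%N].
Proof.
move=> [[n0 _ fM] f1] ug cov.
have [H [HE HM]] := lift_morphism ug cov fM.
case: ug => [[_ ginj _] g1].
pose i0 := Ordinal n0; pose k := \rank (H (delta_mx i0 i0)).
have rk x : \rank (H x) = (\rank x * k)%N by apply: mxrank_mul.
exists k, H; split=> //.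
have H1 : H 1%:M = 1%:M by apply: ginj; rewrite HE f1 g1.
by rewrite -(mxrank1 F m) -H1 rk mxrank1 mulnC.
Qed.

Hypothesis lmA : locally_matrix A.

Lemma exists_cover (s : seq A) :
  exists n (f : {linear 'M[F]_n -> A}),
    unital_embedding f /\ (forall a, a \in s -> covers f a).
Proof.
have [n [f [ef cov]]] := lmA (1 :: s); exists n, f; split.
  by apply: unital_embedding_range => //; apply: cov; rewrite mem_head.
move=> a sa; have [|x _ fx] := cov a; last by exists x.
by rewrite inE sa orbT.
Qed.

(** Whichever subalgebra [xget] chose, it lies together with that of [f] in a larger one; passing
    there scales the rank and the degree by the same factor. *)
Lemma normalized_rankE n (f : {linear 'M[F]_n -> A}) x : unital_embedding f ->
  normalized_rank (f x) = (\rank x)%:R / n%:R.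
Proof.
move=> uf; rewrite /normalized_rank; case: xgetP => [q _|/(_ ((\rank x)%:R / n%:R))].
  case=> m [g [y [eg rg gy ->]]].
  have ug := unital_embedding_range eg rg.
  have [l [k [uk cov]]] := exists_cover (mx_gens f ++ mx_gens g).
  have [|a [H [la HE _ rH]]] := embedding_degree uf uk.
    by apply: covers_gens => b bf; apply: cov; rewrite mem_cat bf.
  have [|b [K [lb KE _ rK]]] := embedding_degree ug uk.
    by apply: covers_gens => c cf; apply: cov; rewrite mem_cat cf orbT.
  have HK : H x = K y by case: uk => [[_ kinj _] _]; apply: kinj; rewrite HE KE.
  have [[n0 _ _] _] := uf; have [[m0 _ _] _] := ug; have [[l0 _ _] _] := uk.
  have a0 : (0 < a)%N by move: l0; rewrite la muln_gt0 => /andP[].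
  have b0 : (0 < b)%N by move: l0; rewrite lb muln_gt0 => /andP[].
  apply/eqP; rewrite eqr_div ?pnatr_eq0 -?lt0n // -!natrM eqr_nat.
  rewrite -(eqn_pmul2r a0) -(eqn_pmul2r b0); apply/eqP.
  have := rH x; rewrite HK rK => E.
  transitivity (\rank y * b * (a * n))%N; first lia.
  by rewrite E -la lb; lia.
(* The default value of [xget] is excluded, since [f] itself provides a value. *)
by case; exists n, f, x; split=> //; [case: uf | apply: range_unital_embedding].
Qed.

End LocallyMatrix.

(** * Locally finite Steinitz numbers *)

Lemma bounded_nat_max (S : set nat) k0 m :
  S k0 -> (forall k, S k -> (k <= m)%N) ->
  exists2 k, S k & forall k', S k' -> (k' <= k)%N.
Proof.
move=> Sk0 Sm; pose P k := `[< S k >].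
have exP : exists k, P k by exists k0; apply/asboolP.
have Pm k : P k -> (k <= m)%N by move/asboolP/Sm.
case: (ex_maxnP exP Pm) => k /asboolP Sk mk; exists k => // k' Sk'.
exact/mk/asboolP.
Qed.

(* The antihomomorphism is stored as the multiplicative map k such that it equals
   x |-> k x^T. *)
Definition hom_antihom_sum (F : fieldType) (A : algType F) (n : nat)
    (Phi : 'M[F]_n -> A) (h k : {linear 'M[F]_n -> A}) : Prop :=
  [/\ forall x y, h (x *m y) = h x * h y, forall x y, k (x *m y) = k x * k y,
     forall x y, h x * k y = 0, forall x y, k x * h y = 0 &
     forall x, Phi x = h x + k x^T].

(** In the product the [h] part is [h (uvuv) = h (uv)], while the [k] part contains [(uuv)^T = 0].
    Thus [h] at [u *m v] is determined by [Phi] alone. *)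
Lemma hom_antihom_sum_corner (F : fieldType) (A : algType F) (n : nat)
    (Phi : 'M[F]_n -> A) (h k : {linear 'M[F]_n -> A}) u v :
  hom_antihom_sum Phi h k -> u *m u = 0 -> u *m v *m u = u ->
  h (u *m v) = Phi (u *m v) * Phi u * Phi v.
Proof.
move=> [hM kM hk kh PhiE] uu uvu.
have hkM x y x' y' : (h x + k x') * (h y + k y') = h (x *m y) + k (x' *m y').
  by rewrite mulrDl !mulrDr hk kh addr0 add0r hM kM.
rewrite !PhiE !hkM uvu -trmx_mul mulmxA uu mul0mx trmx0 mul0mx.
by rewrite linear0 addr0.
Qed.

Lemma dvdn_logn (m r : nat) : (0 < m)%N -> (0 < r)%N ->
  (forall p, p \in primes m -> (logn p m <= logn p r)%N) -> (m %| r)%N.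
Proof.
move=> m0 r0 le; apply/dvdn_partP => // p pm.
have pp : prime p by move: pm; rewrite mem_primes => /andP[].
by rewrite p_part pfactor_dvdn // le.
Qed.

Section LocallyFinite.
Variables (F : fieldType) (A : algType F).
Hypothesis lmA : locally_matrix A.

Lemma cover_max_exponent (p : nat) : prime p -> locally_finite (st A) ->
  exists n (f : {linear 'M[F]_n -> A}), unital_embedding f /\
    forall m (g : {linear 'M[F]_m -> A}), unital_embedding g ->
      (logn p m <= logn p n)%N.
Proof.
move=> pp /(_ (exist _ p pp)).
rewrite /st /steinitz_lcm /exponent_sup /=; case: pselect => // -[b /asboolP bd] _.
have [n0 [f0 [uf0 _]]] := exists_cover lmA [::].
have degP m : matrix_degrees A m <-> exists g : {linear 'M[F]_m -> A}, unital_embedding g.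
  split=> [[g [eg rg]]|[g ug]]; exists g; first exact: unital_embedding_range.
  by split; [case: ug | apply: range_unital_embedding].
have in0 : (logn p @` matrix_degrees A)%classic (logn p n0).
  by exists n0 => //; apply/degP; exists f0.
have [_ [n /degP[f uf] <-] mx] := bounded_nat_max in0 bd.
exists n, f; split=> // m g ug; apply: mx; exists m => //.
by apply/degP; exists g.
Qed.

(** A maximal exponent survives enlarging the subalgebra, because the old degree divides the new
    one; so finitely many primes can be treated one after another. *)
Lemma cover_max_exponents (ps : seq nat) (s : seq A) : locally_finite (st A) ->
  exists n (f : {linear 'M[F]_n -> A}),
    [/\ unital_embedding f, forall a, a \in s -> covers f a &
      forall p, p \in ps -> prime p ->
      forall m (g : {linear 'M[F]_m -> A}), unital_embedding g ->
      (logn p m <= logn p n)%N].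
Proof.
move=> lf; elim: ps s => [|p ps IH] s.
  by have [n [f [uf cf]]] := exists_cover lmA s; exists n, f.
have [pp|npp] := boolP (prime p); last first.
  have [n [f [uf cf mf]]] := IH s; exists n, f; split=> // q.
  by rewrite inE => /predU1P[->|/mf//]; rewrite (negbTE npp).
have [m [g [ug mg]]] := cover_max_exponent pp lf.
have [n [f [uf cf mf]]] := IH (s ++ mx_gens g); exists n, f; split=> //.
  by move=> a sa; apply: cf; rewrite mem_cat sa.
move=> q; rewrite inE => /predU1P[-> _ l k uk|/mf//].
apply: leq_trans (mg _ _ uk) _.
have [|c [H [E _ _ _]]] := embedding_degree ug uf.
  by apply: covers_gens => a ga; apply: cf; rewrite mem_cat ga orbT.
have [[n0 _ _] _] := uf.
by apply: dvdn_leq_log => //; rewrite E dvdn_mull.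
Qed.

(** * Unital rank-preserving maps restricted to matrix subalgebras *)

Variable phi : {linear A -> A}.
Hypotheses (phi_rank : normalized_rank_preserving phi) (phi1 : phi 1 = 1).

Lemma rank_preserving_idempotent p : p * p = p -> phi p * phi p = phi p.
Proof.
move=> pp; have [n [f [uf cf]]] := exists_cover lmA [:: p; phi p].
have [P fP] : covers f p by apply: cf; rewrite mem_head.
have [Q fQ] : covers f (phi p) by apply: cf; rewrite !inE eqxx orbT.
have [[n0 finj fM] f1] := uf.
have n0F : n%:R != 0 :> rat by rewrite pnatr_eq0 -lt0n.
have rkE x y : f y = phi (f x) -> \rank y = \rank x.
  move=> E; have := phi_rank (f x); rewrite -E !normalized_rankE //.
  by move/(mulIf (invr_neq0 n0F))/eqP; rewrite eqr_nat => /eqP.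
have PP : P *m P = P by apply: finj; rewrite fM fP.
have QQ : Q *m Q = Q; last by rewrite -fQ -fM QQ.
apply: idempotent_of_rank_compl; rewrite (rkE P Q) ?fP // (rkE (1%:M - P) (1%:M - Q)).
  exact: mxrank_idempotent_compl.
by rewrite !linearB /= f1 fP fQ phi1.
Qed.

Hypothesis charF : 2%N \notin [pchar F].

Lemma rank_preserving_decomposition n (f : {linear 'M[F]_n -> A}) :
  unital_embedding f -> (1 < n)%N ->
  exists h k, hom_antihom_sum (phi \o f) h k.
Proof.
move=> [[_ _ fM] f1] n1.
have idem x : x *m x = x -> (phi \o f) x * (phi \o f) x = (phi \o f) x.
  by move=> xx /=; apply: rank_preserving_idempotent; rewrite -fM xx.
have [h [k hk]] := jordan_decomposition charF n1 (jordan_of_idempotents charF idem).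
by exists h, k.
Qed.

(** The identity is the sum of the [E_ii = E_ij *m E_ji] with [j != i], and [hom_antihom_sum_corner]
    expresses both homomorphism parts at such a product through [phi] alone. *)
Lemma hom_part_unique n m (f : {linear 'M[F]_n -> A}) (g : {linear 'M[F]_m -> A})
    h k h' k' :
  unital_embedding f -> unital_embedding g -> (forall x, covers g (f x)) ->
  (1 < n)%N -> hom_antihom_sum (phi \o f) h k -> hom_antihom_sum (phi \o g) h' k' ->
  h 1%:M = h' 1%:M.
Proof.
move=> uf ug cov n1 hk hk'.
have [_ [H [_ HE HM _]]] := embedding_degree uf ug cov.
have H1 : H 1%:M = 1%:M.
  by case: ug uf => [[_ ginj _] g1] [_ f1]; apply: ginj; rewrite HE f1 g1.
rewrite -H1 mx1_sum_delta !linear_sum; apply: eq_bigr => i _.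
have [j ij] : exists j : 'I_n, j != i.
  have [->|i0] := eqVneq i (Ordinal (ltnW n1)); first by exists (Ordinal n1).
  by exists (Ordinal (ltnW n1)); rewrite eq_sym.
rewrite -(mul_delta_mx j i i) HM.
have uu : delta_mx i j *m delta_mx i j = 0 :> 'M[F]_n.
  by rewrite mul_delta_mx_cond (negbTE ij).
have uvu : delta_mx i j *m delta_mx j i *m delta_mx i j = delta_mx i j :> 'M[F]_n.
  by rewrite !mul_delta_mx.
rewrite (hom_antihom_sum_corner hk uu uvu) (hom_antihom_sum_corner hk') -?HM.
- by rewrite /= !HE.
- by rewrite uu linear0.
- by rewrite uvu.
Qed.

Lemma rank_preserving_hom_or_antihom n (f : {linear 'M[F]_n -> A}) :
  locally_finite (st A) -> unital_embedding f ->
  (forall x y, phi (f x * f y) = phi (f x) * phi (f y)) \/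
  (forall x y, phi (f x * f y) = phi (f y) * phi (f x)).
Proof.
move=> lf uf; have [[n0 finj fM] f1] := uf.
have [n1|] := ltnP 1 n; last first.
  move=> n1; left; have {n1 n0} n1 : n = 1%N by apply/eqP; rewrite eqn_leq n1.
  subst n => x y; rewrite (mx11_scalar x) -scalemx1 linearZ_LR f1.
  by rewrite -scalerAl mul1r !linearZ_LR /= phi1 -scalerAl mul1r.
have [h [k hk]] := rank_preserving_decomposition uf n1.
have [m [g [ug cg]]] := exists_cover lmA [:: h 1%:M].
have [r gr] : covers g (h 1%:M) by apply: cg; rewrite mem_head.
(* [m] is the degree in which [h 1] appears as the matrix [r]; only the primes of [m] matter for
   deciding whether [m] divides [\rank r]. *)
have [N [f' [uf' cf' max]]] := cover_max_exponents (primes m) (mx_gens f) lf.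
have cov := covers_gens cf'.
have [c [_ [EN _ _ _]]] := embedding_degree uf uf' cov.
have [[N0 _ _] _] := uf'; have N1 : (1 < N)%N.
  by rewrite EN (leq_trans n1) // leq_pmull //; move: N0; rewrite EN muln_gt0 => /andP[].
have [h' [k' hk']] := rank_preserving_decomposition uf' N1.
have E1 := hom_part_unique uf uf' cov n1 hk hk'.
have [M [G [uG cG]]] := exists_cover lmA (mx_gens g ++ mx_gens f' ++ mx_gens h').
have [|a [H [Ea HE _ rH]]] := embedding_degree ug uG.
  by apply: covers_gens => x xg; apply: cG; rewrite mem_cat xg.
have [||K [KE KM]] := lift_morphism (h := h') uG.
- by apply: covers_gens => x xg; apply: cG; rewrite !mem_cat xg !orbT.
- by case: hk'.
have [|b [_ [Eb _ _ _]]] := embedding_degree uf' uG.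
  by apply: covers_gens => x xg; apply: cG; rewrite !mem_cat xg orbT.
have [[M0 Ginj _] _] := uG; have [[m0 ginj gM] g1] := ug.
have rr : r *m r = r by case: hk => hM _ _ _ _; apply: ginj; rewrite gM gr -hM mul1mx.
(* The rank of [h 1] in degree [M], computed in two ways: from [r] in degree [m], and as the value
   at the identity of the multiplicative map [K] on degree [N]. *)
have rankE : (\rank r * a = N * \rank (K (delta_mx (Ordinal N0) (Ordinal N0))))%N.
  rewrite -rH; have -> : H r = K 1%:M by apply: Ginj; rewrite HE KE gr E1.
  by rewrite (mxrank_mul KM (Ordinal N0)) mxrank1.
move: rankE; set d := \rank (K _) => rankE.
have rm : (\rank r <= m)%N by apply: rank_leq_row.
(* Let [v] be the exponent of a prime of [m]. Maximality of [N] gives [v(a) + v(m) <= v(N)], and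
   [rankE] gives [v(r) + v(a) = v(N) + v(d)] for the rank of [r]; hence [v(m) <= v(r)], and [m]
   divides a positive rank that is at most [m]. *)
have : \rank r = 0%N \/ \rank r = m.
  have [->|r0] := posnP (\rank r); first by left.
  right; apply/eqP; rewrite eqn_leq rm dvdn_leq //.
  apply: dvdn_logn => // p pm; have pp : prime p by move: pm; rewrite mem_primes => /andP[].
  have pos : [/\ 0 < a, 0 < b & 0 < d]%N.
    have [a0 b0] : (0 < a)%N /\ (0 < b)%N.
      by move: M0 (M0); rewrite {1}Ea Eb !muln_gt0 => /andP[] ? _ /andP[].
    split=> //; rewrite lt0n; apply/negP => /eqP d0.
    by move: rankE; rewrite d0 muln0 => /eqP; rewrite muln_eq0 !eqn0Ngt r0 a0.
  have [a0 b0 d0] := pos.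
  have := max p pm pp _ _ uG; rewrite {1}Ea lognM // => le.
  have := congr1 (logn p) rankE; rewrite !lognM //; lia.
have [hM kM hk0 kh0 PE] := hk.
(* Rank 0 kills [h] and leaves the antihomomorphism; full rank makes the idempotent [r] the
   identity, and then [h 1 = 1] annihilates [k]. *)
case=> [/eqP|rfull].
  rewrite mxrank_eq0 => /eqP r0; right => x y.
  have hz z : h z = 0 by rewrite -[z]mul1mx hM -gr r0 linear0 mul0r.
  have PE' z : phi (f z) = k z^T by have := PE z; rewrite /= hz add0r.
  by rewrite -fM !PE' trmx_mul kM.
left=> x y; have h1 : h 1%:M = 1.
  have ru : r \in unitmx by rewrite -row_full_unit /row_full rfull.
  by rewrite -gr -g1; congr (g _); rewrite -[LHS](mulmxK ru) rr mulmxV.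
have kz z : k z = 0 by rewrite -[LHS]mul1r -h1 hk0.
have PE' z : phi (f z) = h z by have := PE z; rewrite /= kz addr0.
by rewrite -fM !PE' hM.
Qed.

(** A pair violating multiplicativity and a pair violating antimultiplicativity would lie in one
    matrix subalgebra, where one of the two laws holds. *)
Lemma rank_preserving_locally_finite :
  locally_finite (st A) -> homomorphism phi \/ antihomomorphism phi.
Proof.
move=> lf; apply: contrapT => /not_orP[/existsNP[a /existsNP[b nab]]].
move=> /existsNP[c /existsNP[d ncd]].
have [n [f [uf cf]]] := exists_cover lmA [:: a; b; c; d].
have [x fx] : covers f a by apply: cf; rewrite !inE eqxx ?orbT.
have [y fy] : covers f b by apply: cf; rewrite !inE eqxx ?orbT.
have [z fz] : covers f c by apply: cf; rewrite !inE eqxx ?orbT.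
have [w fw] : covers f d by apply: cf; rewrite !inE eqxx ?orbT.
case: (rank_preserving_hom_or_antihom lf uf) => H.
  by apply: nab; rewrite -fx -fy H.
by apply: ncd; rewrite -fz -fw H.
Qed.

End LocallyFinite.

(** * Conjugating sums of a homomorphism and an antihomomorphism *)

Section Intertwiner.
Variables (F : fieldType) (n N : nat) (i0 : 'I_n).
Implicit Types (h k : {linear 'M[F]_n -> 'M[F]_N}) (X Y : 'M[F]_N).

Definition mx_morphism h := forall x y, h (x *m y) = h x *m h y.

(** The matrix-unit form of averaging: it turns an arbitrary [X] into a matrix [T] with
    [h1 x *m T = T *m h2 x]. *)
Definition intertwiner h1 h2 X : 'M[F]_N :=
  \sum_i h1 (delta_mx i i0) *m X *m h2 (delta_mx i0 i).

Lemma intertwinerP h1 h2 X x : mx_morphism h1 -> mx_morphism h2 ->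
  h1 x *m intertwiner h1 h2 X = intertwiner h1 h2 X *m h2 x.
Proof.
move=> h1M h2M; rewrite /intertwiner mulmx_sumr mulmx_suml.
transitivity (\sum_i \sum_j x j i *: (h1 (delta_mx j i0) *m X *m h2 (delta_mx i0 i))).
  apply: eq_bigr => i _; rewrite !mulmxA -h1M.
  have -> : x *m delta_mx i i0 = \sum_j x j i *: delta_mx j i0.
    rewrite [x in LHS]matrix_sum_delta mulmx_suml; apply: eq_bigr => j _.
    rewrite mulmx_suml (bigD1 i) //= -scalemxAl mul_delta_mx big1 ?addr0 // => l li.
    by rewrite -scalemxAl mul_delta_mx_cond (negbTE li) scaler0.
  rewrite linear_sum !mulmx_suml; apply: eq_bigr => j _.
  by rewrite linearZ_LR -!scalemxAl.
rewrite exchange_big; apply: eq_bigr => j _ /=; rewrite -!mulmxA -h2M.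
have -> : delta_mx i0 j *m x = \sum_i x j i *: delta_mx i0 i.
  rewrite [x in LHS]matrix_sum_delta mulmx_sumr (bigD1 j) //= [X in _ + X]big1 ?addr0.
    rewrite mulmx_sumr; apply: eq_bigr => l _.
    by rewrite -scalemxAr mul_delta_mx.
  move=> l lj; rewrite mulmx_sumr big1 // => l' _.
  by rewrite -scalemxAr mul_delta_mx_cond eq_sym (negbTE lj) scaler0.
rewrite linear_sum !mulmx_sumr; apply: eq_bigr => i _.
by rewrite linearZ_LR -!scalemxAr !mulmxA.
Qed.

Lemma mul_intertwiner h1 h2 h3 X Y : mx_morphism h2 ->
  intertwiner h1 h2 X *m intertwiner h2 h3 Y
    = intertwiner h1 h3 (X *m h2 (delta_mx i0 i0) *m Y).
Proof.
move=> h2M; rewrite /intertwiner mulmx_suml; apply: eq_bigr => i _.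
rewrite mulmx_sumr (bigD1 i) //= big1 ?addr0.
  by rewrite !mulmxA -(mulmxA (_ *m X)) -h2M mul_delta_mx.
move=> j ji; rewrite !mulmxA -(mulmxA (_ *m X)) -h2M mul_delta_mx_cond.
by rewrite eq_sym (negbTE ji) linear0 mulmx0 !mul0mx.
Qed.

Lemma mul_intertwiner_orth h1 h2 h3 h4 X Y : (forall x y, h2 x *m h3 y = 0) ->
  intertwiner h1 h2 X *m intertwiner h3 h4 Y = 0.
Proof.
move=> h23; rewrite /intertwiner mulmx_suml big1 // => i _.
rewrite mulmx_sumr big1 // => j _.
by rewrite !mulmxA -(mulmxA (_ *m X)) h23 mulmx0 !mul0mx.
Qed.

Lemma intertwiner_diag h : mx_morphism h ->
  intertwiner h h (h (delta_mx i0 i0)) = h 1%:M.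
Proof.
move=> hM; rewrite /intertwiner mx1_sum_delta linear_sum; apply: eq_bigr => i _.
by rewrite -!hM !mul_delta_mx.
Qed.

(** Both idempotents factor through a space of dimension [d]; [X] and [Y] cross from one
    factorization to the other. *)
Lemma idempotent_equiv (P Q : 'M[F]_N) : P *m P = P -> Q *m Q = Q ->
  \rank P = \rank Q -> exists X Y, X *m Q *m Y = P /\ Y *m P *m X = Q.
Proof.
move=> PP QQ /esym; move rP : (\rank P) => d rQ.
have [l [r [-> rl]]] := idem_rank_factor PP rP.
have [l' [r' [-> rl']]] := idem_rank_factor QQ rQ.
exists (l *m r'), (l' *m r); split.
  by rewrite !mulmxA -(mulmxA l) rl' mulmx1 -(mulmxA l) rl' mulmx1.
by rewrite !mulmxA -(mulmxA l') rl mulmx1 -(mulmxA l') rl mulmx1.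
Qed.

Lemma mxrank_delta_eq h h' : mx_morphism h -> mx_morphism h' ->
  \rank (h 1%:M) = \rank (h' 1%:M) ->
  \rank (h (delta_mx i0 i0)) = \rank (h' (delta_mx i0 i0)).
Proof.
move=> hM h'M; rewrite (mxrank_mul hM i0) (mxrank_mul h'M i0) mxrank1.
by move/eqP; rewrite eqn_pmul2l ?(leq_trans _ (ltn_ord i0)) // => /eqP.
Qed.

(** Equal ranks make the corners at [E_i0i0] equivalent, and intertwiners spread these equivalences
    to all of the images. Cross terms in [U *m V] vanish by orthogonality, leaving
    [h 1 + k 1 = 1]. *)
Lemma pair_conjugate h k h' k' :
  mx_morphism h -> mx_morphism k -> mx_morphism h' -> mx_morphism k' ->
  (forall x y, h x *m k y = 0) -> (forall x y, k x *m h y = 0) ->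
  (forall x y, h' x *m k' y = 0) -> (forall x y, k' x *m h' y = 0) ->
  h 1%:M + k 1%:M = 1%:M -> 
  \rank (h 1%:M) = \rank (h' 1%:M) -> \rank (k 1%:M) = \rank (k' 1%:M) ->
  exists U V, [/\ U *m V = 1%:M, V *m U = 1%:M,
    forall x, h x = U *m h' x *m V & forall x, k x = U *m k' x *m V].
Proof.
move=> hM kM h'M k'M hk kh hk' kh' hk1 rh rk.
have idem (f : {linear 'M[F]_n -> 'M[F]_N}) : mx_morphism f ->
    f (delta_mx i0 i0) *m f (delta_mx i0 i0) = f (delta_mx i0 i0).
  by move=> fM; rewrite -fM mul_delta_mx.
have [X [Y [XY _]]] := idempotent_equiv (idem h hM) (idem h' h'M) (mxrank_delta_eq hM h'M rh).
have [Z [W [ZW _]]] := idempotent_equiv (idem k kM) (idem k' k'M) (mxrank_delta_eq kM k'M rk).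
pose U := intertwiner h h' X + intertwiner k k' Z.
pose V := intertwiner h' h Y + intertwiner k' k W.
have UV : U *m V = 1%:M.
  rewrite mulmxDl !mulmxDr !mul_intertwiner // !mul_intertwiner_orth //.
  by rewrite addr0 add0r XY ZW !intertwiner_diag.
have conj (f f' g g' : {linear 'M[F]_n -> 'M[F]_N}) S T x :
    mx_morphism f -> mx_morphism f' ->
    (forall x y, f x *m g y = 0) -> (forall x y, g' x *m f' y = 0) ->
    f x *m (intertwiner f f' S + intertwiner g g' T)
      = (intertwiner f f' S + intertwiner g g' T) *m f' x.
  move=> fM f'M fg gf'; rewrite mulmxDl mulmxDr intertwinerP //; congr (_ + _).
  rewrite /intertwiner mulmx_sumr mulmx_suml !big1 // => i _.
    by rewrite -mulmxA gf' mulmx0.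
  by rewrite !mulmxA fg !mul0mx.
exists U, V; split=> //; first exact: mulmx1C.
  by move=> x; rewrite -conj // -mulmxA UV mulmx1.
by move=> x; rewrite /U addrC -conj // -mulmxA (addrC (intertwiner k _ _)) UV mulmx1.
Qed.

(** The centralizer of the image of [h] is a copy of the [d] by [d] matrices, realized on the corner
    cut out by [P]; [e] is the element of it corresponding to [pid_mx c]. *)
Lemma centralizer_idempotent h c d : mx_morphism h -> h 1%:M = 1%:M ->
  N = (n * d)%N -> (c <= d)%N ->
  exists e : 'M[F]_N,
    [/\ e *m e = e, forall x, e *m h x = h x *m e & \rank e = (n * c)%N].
Proof.
move=> hM h1 Nd cd; set P := h (delta_mx i0 i0).
have n0 : (0 < n)%N := leq_trans (ltn0Sn _) (ltn_ord i0).
have PP : P *m P = P by rewrite -hM mul_delta_mx.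
have rP : \rank P = d.
  have := mxrank_mul hM i0 1%:M; rewrite h1 !mxrank1 [in LHS]Nd.
  by move/eqP; rewrite eqn_pmul2l // => /eqP.
have [l [r [PE rl]]] := idem_rank_factor PP rP.
pose D : 'M[F]_N := l *m pid_mx c *m r.
have PD : P *m D = D by rewrite PE /D !mulmxA -(mulmxA l r) rl mulmx1.
have DP : D *m P = D by rewrite PE /D !mulmxA -(mulmxA _ r l) rl mulmx1.
have DD : D *m D = D.
  by rewrite {2}/D /D !mulmxA -(mulmxA _ r l) rl mulmx1 -(mulmxA l) pid_mx_id.
pose e := intertwiner h h D.
have ee : e *m e = e by rewrite mul_intertwiner // -/P DP DD.
have eh x : e *m h x = h x *m e by rewrite intertwinerP.
exists e; split=> //.
(* Since [e] commutes with the image of [h], [g] is multiplicative, and the rank of [e = g 1] is [n]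
   times that of the corner [D]. *)
pose g : {linear 'M[F]_n -> 'M[F]_N} := mulmx e \o h.
have gM x y : g (x *m y) = g x *m g y.
  by rewrite /g /= hM !mulmxA -(mulmxA e (h x) e) -eh mulmxA ee.
have -> : e = g 1%:M by rewrite /g /= h1 mulmx1.
rewrite (mxrank_mul gM i0) mxrank1; congr (_ * _)%N.
have -> : g (delta_mx i0 i0) = D.
  rewrite /g /= -/P /e /intertwiner mulmx_suml (bigD1 i0) //= big1 ?addr0.
    by rewrite -/P PD -mulmxA PP DP.
  move=> i ii; rewrite -(mulmxA _ _ P) /P -hM mul_delta_mx_cond (negbTE ii) mulr0n.
  by rewrite linear0 mulmx0.
by rewrite mxrank_factor_conj // rank_pid_mx.
Qed.

End Intertwiner.

(** * Steinitz numbers that are not locally finite *)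

Section NotLocallyFinite.
Variables (F : fieldType) (A : algType F).
Hypothesis lmA : locally_matrix A.

Lemma not_locally_finite_exponents : ~ locally_finite (st A) ->
  exists2 p : nat, prime p & forall b, exists n (f : {linear 'M[F]_n -> A}),
    unital_embedding f /\ (b <= logn p n)%N.
Proof.
move=> /existsNP[[p pp] /contrapT]; rewrite /st /steinitz_lcm /exponent_sup /=.
case: pselect => // unb _; exists p => // b; apply: contrapT => nex; apply: unb.
exists b; apply/asboolP => k [n [f [ef rf]] <-]; rewrite leqNgt; apply/negP => bn.
by apply: nex; exists n, f; split; [apply: unital_embedding_range | apply: ltnW].
Qed.

(** A stage is a matrix subalgebra with a partial map on it, split into its two parts; the parts
    take values in [A] and may leave the subalgebra. *)
Record stage := Stage {
  degree : nat;
  emb : {linear 'M[F]_degree -> A};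
  hom_part : {linear 'M[F]_degree -> A};
  anti_part : {linear 'M[F]_degree -> A} }.

Definition stage_map (S : stage) (x : 'M[F]_(degree S)) : A :=
  hom_part S x + anti_part S x^T.

Variable p : nat.
(** The value [1/p] lies strictly between 0 and 1, so both parts are nonzero, and it can be kept at
    every stage because the exponents of [p] are unbounded. *)
Definition stage_ok (S : stage) : Prop :=
  [/\ unital_embedding (emb S),
      hom_antihom_sum (@stage_map S) (hom_part S) (anti_part S),
      hom_part S 1%:M + anti_part S 1%:M = 1 &
      normalized_rank (hom_part S 1%:M) = p%:R^-1].

Definition stage_le (S T : stage) : Prop :=
  forall x, exists y, emb T y = emb S x /\ stage_map y = stage_map x.

Lemma stage_le_refl S : stage_le S S.
Proof. by move=> x; exists x. Qed.

Lemma stage_le_trans S T U : stage_le S T -> stage_le T U -> stage_le S U.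
Proof.
move=> ST TU x; have [y [ey my]] := ST x; have [z [ez mz]] := TU y.
by exists z; rewrite ez mz.
Qed.

Lemma stage_lift (S : stage) (s : seq A) : stage_ok S ->
  exists N (g : {linear 'M[F]_N -> A}) (H K : {linear 'M[F]_(degree S) -> 'M[F]_N}),
  [/\ [/\ unital_embedding g, forall a, a \in s -> covers g a &
        forall x, covers g (emb S x)],
      [/\ forall x, g (H x) = hom_part S x, forall x, g (K x) = anti_part S x,
        mx_morphism H & mx_morphism K],
      (forall x y, H x *m K y = 0), (forall x y, K x *m H y = 0) &
      H 1%:M + K 1%:M = 1%:M].
Proof.
move=> [ue [hM kM hk kh _] h1k1 _].
have [N [g [ug cg]]] := exists_cover lmA
  (s ++ mx_gens (emb S) ++ mx_gens (hom_part S) ++ mx_gens (anti_part S)).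
have [||H [HE HM]] := lift_morphism (h := hom_part S) ug.
- by apply: covers_gens => a ia; apply: cg; rewrite !mem_cat ia !orbT.
- exact: hM.
have [||K [KE KM]] := lift_morphism (h := anti_part S) ug.
- by apply: covers_gens => a ia; apply: cg; rewrite !mem_cat ia !orbT.
- exact: kM.
have [[_ ginj gM] g1] := ug.
exists N, g, H, K; split=> //; first split=> //.
- by move=> a ia; apply: cg; rewrite !mem_cat ia.
- by apply: covers_gens => a ia; apply: cg; rewrite !mem_cat ia !orbT.
- by move=> x y; apply: ginj; rewrite gM HE KE hk linear0.
- by move=> x y; apply: ginj; rewrite gM HE KE kh linear0.
- by apply: ginj; rewrite linearD /= HE KE g1.
Qed.

(** Orthogonality makes the rank of [H y + K z] equal to [\rank y * al + \rank z * be];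
    transposition preserves rank, and the identity shows that [al + be] is the ratio of the
    degrees. *)
Lemma stage_rank S x : stage_ok S ->
  normalized_rank (stage_map x) = normalized_rank (emb S x).
Proof.
move=> okS; have [N [g [H [K [[ug _ _] [HE KE HM KM] HK KH HK1]]]]] := stage_lift [::] okS.
have [ue _ _ _] := okS; rewrite (normalized_rankE lmA x ue).
have -> : stage_map x = g (H x + K x^T) by rewrite linearD /= HE KE.
rewrite (normalized_rankE lmA _ ug).
have [[n0 _ _] _] := ue; have [[N0 _ _] _] := ug; pose i0 := Ordinal n0.
have [al [be rk]] : exists al be, forall y z,
    \rank (H y + K z)%R = (\rank y * al + \rank z * be)%N.
  exists (\rank (H (delta_mx i0 i0))), (\rank (K (delta_mx i0 i0))) => y z.
  rewrite (mxrank_orth_add (e := H 1%:M)) ?HK ?KH -?HM ?mul1mx ?mulmx1 //.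
  by rewrite (mxrank_mul HM i0) (mxrank_mul KM i0).
have := rk 1%:M 1%:M; rewrite HK1 !mxrank1 => NE.
rewrite rk mxrank_tr; apply/eqP; rewrite eqr_div ?pnatr_eq0 -?lt0n //.
by rewrite -!natrM eqr_nat; apply/eqP; lia.
Qed.

Hypothesis p_prime : prime p.

Lemma stage_part_rank S N (g : {linear 'M[F]_N -> A})
    (H : {linear 'M[F]_(degree S) -> 'M[F]_N}) : stage_ok S ->
  unital_embedding g -> (forall x, g (H x) = hom_part S x) ->
  (p * \rank (H 1%:M) = N)%N.
Proof.
move=> [_ _ _ nr] ug HE; have [[N0 _ _] _] := ug.
move: nr; rewrite -HE (normalized_rankE lmA _ ug) => /eqP.
rewrite -[p%:R^-1]div1r eqr_div ?pnatr_eq0 -?lt0n ?(prime_gt0 p_prime) //.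
by rewrite mul1r -natrM eqr_nat mulnC => /eqP.
Qed.

(** As [1/p] is neither 0 nor 1, [H] and [K] are both nonzero, and a nonzero multiplicative map is
    injective by [mxrank_mul]. This later rules out both multiplicative laws. *)
Lemma stage_part_inj S z : stage_ok S ->
  hom_part S z = 0 \/ anti_part S z = 0 -> z = 0.
Proof.
move=> okS; have [N [g [H [K [[ug _ _] [HE KE HM KM] HK KH HK1]]]]] := stage_lift [::] okS.
have pN := stage_part_rank okS ug HE.
have [[_ ginj _] _] := ug; have [[[n0 _ _] _] _ _ _] := okS.
have [[N0 _ _] _] := ug.
have p1 := prime_gt1 p_prime.
have H1 : \rank (H 1%:M) != 0%N.
  by apply/eqP => r0; move: N0; rewrite -pN r0 muln0.
have K1 : \rank (K 1%:M) != 0%N.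
  apply/eqP => /eqP; rewrite mxrank_eq0 => /eqP K0.
  by move: pN; rewrite -[H _]addr0 -K0 HK1 mxrank1; nia.
have inj0 (f : {linear 'M[F]_(degree S) -> 'M[F]_N}) : mx_morphism f ->
    \rank (f 1%:M) != 0%N -> f z = 0 -> z = 0.
  move=> fM; rewrite (mxrank_mul fM (Ordinal n0)) muln_eq0 negb_or => /andP[_ d0] fz.
  apply/eqP; rewrite -mxrank_eq0; move: (mxrank_mul fM (Ordinal n0) z).
  by rewrite fz mxrank0 => /esym/eqP; rewrite muln_eq0 (negbTE d0) orbF.
case=> [h0|k0]; [apply: (inj0 H) | apply: (inj0 K)] => //; apply: ginj.
  by rewrite HE h0 linear0.
by rewrite KE k0 linear0.
Qed.

Hypothesis p_unbounded : forall b, exists n (f : {linear 'M[F]_n -> A}),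
  unital_embedding f /\ (b <= logn p n)%N.

Lemma stage_init : exists S, stage_ok S.
Proof.
have [N [g [ug pN]]] := p_unbounded 1.
have [[N0 ginj gM] g1] := ug.
have pdN : (p %| N)%N.
  by rewrite -[p]expn1 pfactor_dvdn.
have lin (a : A) : linear (fun x : 'M[F]_1 => x 0 0 *: a).
  by move=> c x y; rewrite !mxE scalerDl scalerA.
have [sc scE] : exists sc : A -> {linear 'M[F]_1 -> A}, forall a x, sc a x = x 0 0 *: a.
  pose sc0 a : {linear 'M[F]_1 -> A} :=
    HB.pack (fun x : 'M[F]_1 => x 0 0 *: a) (GRing.isLinear.Build F _ A _ _ (lin a)).
  by exists sc0.
have scM a b x y : sc a x * sc b y = (x *m y) 0 0 *: (a * b).
  by rewrite !scE mxE big_ord1 -scalerAl -scalerAr scalerA.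
pose e : 'M[F]_N := pid_mx (N %/ p).
have ee : e *m e = e by rewrite pid_mx_id // leq_div.
(* The first stage is the subalgebra of scalars; [e] has rank [N / p], so [g e] has normalized rank
   [1/p]. *)
exists (@Stage 1 (sc 1) (sc (g e)) (sc (g (1%:M - e)))); split=> /=.
- split; last by rewrite scE mxE eqxx scale1r.
  split=> // [x y|x y]; last by rewrite scM mulr1.
  rewrite !scE => /eqP; rewrite -subr_eq0 -scalerBl scaler_eq0 oner_eq0 orbF subr_eq0.
  by move=> /eqP xy; apply/matrixP => i j; rewrite !ord1.
- split=> //= x y; rewrite scM -gM.
  + by rewrite ee.
  + by rewrite mulmxBr mulmx1 mulmxBl mul1mx ee subrr subr0.
  + by rewrite mulmxBr mulmx1 ee subrr linear0 scaler0.
  + by rewrite mulmxBl mul1mx ee subrr linear0 scaler0.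
- by rewrite !scE !mxE eqxx !scale1r -linearD /= subrKC.
- rewrite scE mxE eqxx scale1r (normalized_rankE lmA _ ug) rank_pid_mx ?leq_div //.
  apply/eqP; rewrite -[p%:R^-1]div1r eqr_div ?pnatr_eq0 -?lt0n ?(prime_gt0 p_prime) //.
  by rewrite mul1r -natrM divnK.
Qed.

(** The model map on degree [n] has parts [e *m theta x] and [(1 - e) *m theta x^T], with [e] of
    rank [N / p] in the centralizer of [theta]. On the old subalgebra it has the same part ranks as
    the given map, so one conjugation makes it an extension. *)
Lemma stage_extend S b : stage_ok S ->
  exists T, [/\ stage_ok T, stage_le S T & covers (emb T) b].
Proof.
move=> okS; have [ue _ _ _] := okS.
have [n [f [uf cf]]] := exists_cover lmA (b :: mx_gens (emb S)).
have [|_ [iota [_ iotaE iotaM _]]] := embedding_degree ue uf.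
  by apply: covers_gens => a ia; apply: cf; rewrite inE ia orbT.
(* Exceeding the exponent of [p] in [n] ensures that [p] divides the ratio [a = N / n]. *)
have [d [g0 [ug0 pd]]] := p_unbounded (logn p n).+1.
have [N [g [H [K [[ug cg _] [HE KE HM KM] HK KH HK1]]]]] :=
  stage_lift (mx_gens f ++ mx_gens g0) okS.
have [|a [theta [Na thetaE thetaM _]]] := embedding_degree uf ug.
  by apply: covers_gens => x ix; apply: cg; rewrite mem_cat ix.
have [|a0 [_ [Na0 _ _ _]]] := embedding_degree ug0 ug.
  by apply: covers_gens => x ix; apply: cg; rewrite mem_cat ix orbT.
have [[n0 finj fM] f1] := uf; have [[N0 ginj gM] g1] := ug.
have p0 := prime_gt0 p_prime.
have /dvdnP[c ac] : (p %| a)%N.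
  have [a_gt0 a0_gt0 d0] : [/\ 0 < a, 0 < a0 & 0 < d]%N.
    by split; move: N0 (N0); rewrite {1}Na Na0 !muln_gt0 => /andP[] ? ? /andP[].
  rewrite -[p]expn1 pfactor_dvdn //.
  have := congr1 (logn p) (etrans (esym Na) Na0); rewrite !lognM //; lia.
have iota1 : iota 1%:M = 1%:M by apply: finj; rewrite iotaE f1; case: ue.
have theta1 : theta 1%:M = 1%:M by apply: ginj; rewrite thetaE f1 g1.
have NE : N = (n * a)%N by rewrite Na mulnC.
have ca : (c <= a)%N by rewrite ac leq_pmulr.
have [e [ee eC re]] := centralizer_idempotent (Ordinal n0) thetaM theta1 NE ca.
have fe : (1%:M - e) *m (1%:M - e) = 1%:M - e.
  by rewrite mulmxBr mulmx1 mulmxBl mul1mx ee subrr subr0.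
have fC x : (1%:M - e) *m theta x = theta x *m (1%:M - e).
  by rewrite mulmxBl mulmxBr mul1mx mulmx1 eC.
pose cut (q : 'M[F]_N) : {linear 'M[F]_n -> 'M[F]_N} := mulmx q \o theta.
have cutE q x : cut q x = q *m theta x by [].
have cutM q q' x y : q' *m theta x = theta x *m q' ->
    cut q x *m cut q' y = (q *m q') *m theta (x *m y).
  by move=> C; rewrite !cutE thetaM !mulmxA -(mulmxA q) -C !mulmxA.
pose h' : {linear 'M[F]_(degree S) -> 'M[F]_N} := cut e \o iota.
(* The inner transpose undoes the one built into [stage_map], and the outer one makes [k']
   multiplicative; [iota] need not commute with transposition. *)
pose k' : {linear 'M[F]_(degree S) -> 'M[F]_N} :=
  cut (1%:M - e) \o (trmx \o (iota \o trmx)).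
have k'E x : k' x = cut (1%:M - e) (iota x^T)^T by [].
have h'E x : h' x = cut e (iota x) by [].
have ef : e *m (1%:M - e) = 0 by rewrite mulmxBr mulmx1 ee subrr.
have fe0 : (1%:M - e) *m e = 0 by rewrite mulmxBl mul1mx ee subrr.
have cutMe x y : cut e (x *m y) = cut e x *m cut e y by rewrite cutM ?ee.
have cutMf x y : cut (1%:M - e) (x *m y) = cut (1%:M - e) x *m cut (1%:M - e) y.
  by rewrite cutM ?fe.
have cutef x y : cut e x *m cut (1%:M - e) y = 0 by rewrite cutM // ef mul0mx.
have cutfe x y : cut (1%:M - e) x *m cut e y = 0 by rewrite cutM // fe0 mul0mx.
have h'M : mx_morphism h' by move=> x y; rewrite !h'E iotaM cutMe.
have k'M : mx_morphism k'.
  by move=> x y; rewrite !k'E trmx_mul iotaM trmx_mul cutMf.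
have rh : \rank (H 1%:M) = \rank (h' 1%:M).
  rewrite h'E iota1 cutE theta1 mulmx1 re.
  by apply/eqP; rewrite -(eqn_pmul2l p0) (stage_part_rank okS ug HE) NE ac; apply/eqP; lia.
have rk : \rank (K 1%:M) = \rank (k' 1%:M).
  rewrite k'E trmx1 iota1 trmx1 cutE theta1 mulmx1.
  have -> : K 1%:M = 1%:M - H 1%:M by rewrite -HK1 addrAC subrr add0r.
  apply/eqP; rewrite -(eqn_add2l (\rank (H 1%:M))).
  rewrite mxrank_idempotent_compl -?HM ?mul1mx // rh h'E iota1 cutE theta1 mulmx1.
  by rewrite mxrank_idempotent_compl.
have nS0 : (0 < degree S)%N by case: ue => [[]].
have [U [V [UV VU hU kU]]] := pair_conjugate (Ordinal nS0) HM KM h'M k'M HK KH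
  (fun x y => cutef _ _) (fun x y => cutfe _ _) HK1 rh rk.
(* The conjugation found on the old subalgebra is applied to the model parts on all of degree
   [n]. *)
pose cj (q : 'M[F]_N) : {linear 'M[F]_n -> A} := g \o (mulmxr V \o (mulmx U \o cut q)).
have cjE q x : cj q x = g (U *m cut q x *m V) by [].
have cjM q q' x y : cj q x * cj q' y = g (U *m (cut q x *m cut q' y) *m V).
  by rewrite !cjE -gM !mulmxA -(mulmxA _ V U) VU mulmx1.
exists (@Stage n f (cj e) (cj (1%:M - e))); split.
- split=> //.
  + split=> // x y.
    * by rewrite cjM -cutMe.
    * by rewrite cjM -cutMf.
    * by rewrite cjM cutef mulmx0 mul0mx linear0.
    * by rewrite cjM cutfe mulmx0 mul0mx linear0.
  + rewrite !cjE !cutE !theta1 !mulmx1 -linearD -mulmxDl -mulmxDr subrKC mulmx1.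
    by rewrite UV g1.
  + rewrite cjE cutE theta1 mulmx1 (normalized_rankE lmA _ ug) mxrank_factor_conj // re.
    apply/eqP; rewrite -[p%:R^-1]div1r eqr_div ?pnatr_eq0 -?lt0n // mul1r -natrM eqr_nat.
    by rewrite NE ac; apply/eqP; lia.
- move=> x; exists (iota x); split; first exact: iotaE.
  by rewrite /stage_map /= -HE -KE hU kU h'E k'E trmxK.
by apply: cf; rewrite mem_head.
Qed.

End NotLocallyFinite.

(** * An exhausting chain of stages and its limit map *)

Lemma stage_sequence (F : fieldType) (A : algType F) (p : nat) (b : nat -> A) :
  locally_matrix A -> prime p ->
  (forall e, exists n (f : {linear 'M[F]_n -> A}),
    unital_embedding f /\ (e <= logn p n)%N) ->
  exists S : nat -> stage A,
    [/\ forall i, stage_ok p (S i),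
        forall i j, (i <= j)%N -> stage_le (S i) (S j) &
        forall i, covers (emb (S i.+1)) (b i)].
Proof.
move=> lmA pp unb.
have step (Sb : {S : stage A | stage_ok p S} * A) :
    exists T : {T : stage A | stage_ok p T},
      stage_le (sval Sb.1) (sval T) /\ covers (emb (sval T)) Sb.2.
  case: Sb => -[S okS] a.
  have [T [okT ST Ta]] := stage_extend lmA pp unb a okS.
  by exists (exist _ T okT).
have [next nextP] := choice step.
have [S0 ok0] := stage_init lmA pp unb.
(* Stage [i + 1] is made to contain [b i], so stage [n] contains the first [n] basis vectors. *)
pose S := fix S i := if i is j.+1 then next (S j, b j) else exist _ S0 ok0.
exists (fun i => sval (S i)); split.
- by move=> i; apply: (svalP (S i)).
- move=> i j /subnK <-; elim: (j - i)%N => [|k IH]; first exact: stage_le_refl.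
  apply: stage_le_trans IH _; exact: (nextP (S (k + i)%N, b (k + i)%N)).1.
- by move=> i; have [] := nextP (S i, b i).
Qed.

Lemma rank_preserving_not_locally_finite (F : fieldType) (A : algType F) :
  locally_matrix A -> ~ locally_finite (st A) -> dim_aleph0 A ->
  exists phi : {linear A -> A},
    [/\ normalized_rank_preserving phi, phi 1 = 1,
        ~ homomorphism phi & ~ antihomomorphism phi].
Proof.
move=> lmA nlf [b [_ bspan]].
have [p pp unb] := not_locally_finite_exponents nlf.
have [S [okS leS covS]] := stage_sequence b lmA pp unb.
have embS i : unital_embedding (emb (S i)) by case: (okS i).
have cover_le i j a : (i <= j)%N -> covers (emb (S i)) a -> covers (emb (S j)) a.
  by move=> ij [x <-]; have [y [ey _]] := leS i j ij x; exists y.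
have cover a : exists i, covers (emb (S i)) a.
  have [n [c ->]] := bspan a; exists n.
  have cb (i : 'I_n) : exists x, emb (S n) x = b i.
    exact: cover_le (ltn_ord i) (covS i).
  have [x xE] := choice cb; exists (\sum_i c i *: x i).
  by rewrite linear_sum; apply: eq_bigr => i _; rewrite linearZ_LR xE.
have /choice[phi0 phi0E] : forall a, exists d, exists i x,
    emb (S i) x = a /\ stage_map x = d.
  by move=> a; have [i [x xE]] := cover a; exists (stage_map x), i, x.
(* The value does not depend on the stage chosen: two stages are compared inside the later one,
   where the embedding is injective. *)
have phiE i x : phi0 (emb (S i) x) = stage_map x.
  have [j [y [ey <-]]] := phi0E (emb (S i) x).
  have [y' [ey' <-]] := leS j _ (leq_maxr i j) y.
  have [x' [ex' <-]] := leS i _ (leq_maxl i j) x.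
  have [[_ inj _] _] := embS (maxn i j).
  by congr stage_map; apply: inj; rewrite ex' ey' ey.
have cover2 u v : exists i x y, emb (S i) x = u /\ emb (S i) y = v.
  have [i cu] := cover u; have [j cv] := cover v; exists (maxn i j).
  have [x xE] := cover_le _ _ _ (leq_maxl i j) cu.
  by have [y yE] := cover_le _ _ _ (leq_maxr i j) cv; exists x, y.
have lphi : linear phi0.
  move=> c u v; have [i [x [y [<- <-]]]] := cover2 u v.
  rewrite -linearP !phiE /stage_map !linearP.
  by rewrite addrACA -scalerDr.
pose phi : {linear A -> A} := HB.pack phi0 (GRing.isLinear.Build F _ A _ _ lphi).
have phiE' i x : phi (emb (S i) x) = stage_map x by apply: phiE.
(* A subalgebra whose degree is divisible by [p] has degree at least 2, hence noncommuting matrix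
   units, which some stage contains. *)
have noncomm : exists i (x y : 'M[F]_(degree (S i))), x *m y - y *m x != 0.
  have [d [f [[[d0 finj fM] _] d1]]] := unb 1%N.
  have d2 : (1 < d)%N by move: d d1 d0 {f finj fM} => [|[|d]] //; rewrite logn1.
  pose i0 := Ordinal d0; pose i1 := Ordinal d2.
  have [i [x [y [xE yE]]]] := cover2 (f (delta_mx i0 i1)) (f (delta_mx i1 i0)).
  exists i, x, y; have [[_ inj eM] _] := embS i.
  rewrite subr_eq0; apply/eqP => /(congr1 (emb (S i))).
  rewrite !eM xE yE -!fM !mul_delta_mx => /finj/matrixP/(_ i0 i0)/eqP.
  by rewrite !mxE eqxx /= oner_eq0.
have [i [x [y /eqP xy]]] := noncomm.
have [_ [hM kM hk kh _] _ _] := okS i.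
have [_ _ eM] := (embS i).1.
have mapM u v : stage_map u * stage_map v =
    hom_part (S i) (u *m v) + anti_part (S i) (v *m u)^T.
  by rewrite mulrDl !mulrDr hk kh addr0 add0r trmx_mul hM kM.
exists phi; split.
- move=> a; have [j [z <-]] := cover a; rewrite phiE'.
  exact: (stage_rank lmA z (okS j)).
- have [_ e1] := embS 0%N; rewrite -e1 phiE' /stage_map trmx1 e1.
  by case: (okS 0%N).
(* Multiplicativity would leave [k (xy)^T = k (yx)^T], against injectivity of [k]; the
   antimultiplicative law would likewise give [h (xy) = h (yx)]. *)
- move=> hom; apply: xy.
  have := hom (emb (S i) x) (emb (S i) y).
  rewrite -eM !phiE' mapM => /addrI/eqP; rewrite -subr_eq0 -!linearB /= => /eqP k0.
  apply: trmx_inj; rewrite trmx0.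
  exact: (stage_part_inj lmA pp (okS i) (or_intror k0)).
- move=> anti; apply: xy.
  have := anti (emb (S i) x) (emb (S i) y).
  rewrite -eM !phiE' mapM => /addIr/eqP; rewrite -subr_eq0 -linearB /= => /eqP h0.
  exact: (stage_part_inj lmA pp (okS i) (or_introl h0)).
Qed.

Unset Implicit Arguments.

Theorem corollary2 (F : fieldType) (A : algType F)
    (charF : 2%N \notin [pchar F]) (lmA : locally_matrix A) :
  (locally_finite (st A) ->
   forall phi : {linear A -> A},
     normalized_rank_preserving phi -> phi 1 = 1 ->
     homomorphism phi \/ antihomomorphism phi) /\
  (~ locally_finite (st A) -> dim_aleph0 A ->
   exists phi : {linear A -> A},
     [/\ normalized_rank_preserving phi, phi 1 = 1,
         ~ homomorphism phi & ~ antihomomorphism phi]).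
Proof.
split=> [lf phi phi_rank phi1|]; last exact: rank_preserving_not_locally_finite.
exact: rank_preserving_locally_finite.
Qed.
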